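(* For every integer $n\ge 1$ the following identities hold: (i) $\tau(n) = -\frac{91}{600} \sigma_{11}(n) + \frac{691}{600} \sigma_3(n) + \frac{4\cdot 691}{5n}\sum_{m=1}^{n-1}m\,\sigma_3(m)\sigma_7(n-m)$; (ii) $\tau(n) = -\frac{91}{600} \sigma_{11}(n) + \frac{691}{600} \sigma_7(n) + \frac{2\cdot 691}{5n}\sum_{m=1}^{n-1}(n-m)\sigma_3(m)\sigma_7(n-m)$.
   Context: $\tau(n)$ is Ramanujan's tau function, defined by $q\prod_{n\ge 1}(1-q^n)^{24} = \sum_{n\ge 1}\tau(n)q^n$. For $k\ge 1$, $\sigma_k(n)=\sum_{d\mid n} d^k$ (sum over positive divisors of $n$). For $n=1$ the sum $\sum_{m=1}^{n-1}$ is empty and equals $0$. *)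

(* Defs.v *)
From mathcomp Require Import all_boot all_order all_algebra.

Set Implicit Arguments.
Unset Strict Implicit.
Unset Printing Implicit Defensive.

Import GRing.Theory.
Local Open Scope ring_scope.

Definition sigma (k n : nat) : nat := (\sum_(d <- divisors n) d ^ k)%N.

(* The infinite product q * prod_(k >= 1) (1 - q^k)^24 is taken in the q-adic
   topology of formal power series: its coefficient of q^n is the eventually
   constant value of the coefficient of q^n in the partial products, already
   reached at k <= n (lemma coef_delta_trunc). *)
Definition delta_trunc (N : nat) : {poly int} :=
  'X * \prod_(1 <= k < N.+1) (1 - 'X^k) ^+ 24.

Definition tau (n : nat) : int := (delta_trunc n)`_n.

Lemma coef_delta_trunc (n N : nat) : (n <= N)%N -> (delta_trunc N)`_n = tau n.
Proof.
elim: N => [|N IHN]; first by rewrite leqn0 => /eqP->.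
rewrite leq_eqVlt => /orP[/eqP-> // | ltnN].
rewrite -IHN // /delta_trunc big_nat_recr //= mulrA -/(delta_trunc N).
have [r ->] : exists r : {poly int}, (1 - 'X^(N.+1)) ^+ 24 = 1 + 'X^(N.+1) * r.
  elim: 24%N => [|m [r IHm]]; first by exists 0; rewrite expr0 mulr0 addr0.
  exists (r - (1 - 'X^(N.+1)) ^+ m).
  by rewrite exprS mulrBl mul1r {1}IHm mulrBr addrA.
by rewrite mulrDr mulr1 mulrCA coefD coefXnM ltnN addr0.
Qed.

(* Main.v *)
Require Import Defs.
From mathcomp Require Import all_boot all_order all_algebra.
From mathcomp Require Import zify ring lra.

Import GRing.Theory.
Local Open Scope ring_scope.

(* With D = q d/dq and the Eisenstein series P, Q, R (called E6 below, R being
   the field of coefficients), E8, E12 of weights 2, 4, 6, 8, 12, the right-hand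
   sums are coefficients of DQ.E8 and Q.DE8. Since E8 = Q^2, these series are
   D(Q^3)/3 and 2D(Q^3)/3, and 691 Q^3 = 691 E12 + 432000 Delta.

   The relations needed (3DQ = PQ - R, 2DR = PR - E8, E8 = Q^2 and
   441 Q.E8 + 250 R^2 = 691 E12) are evaluations of convolutions of divisor
   sums. These are sums of polynomials in a and b over the positive solutions of
   ax + by = n, and follow from one identity of Skoruppa, which is proved by the
   change of variables (a, b, x, y) -> (a + b, b, x, y - x).
   The relations imply D(Q^3 - R^2) = P (Q^3 - R^2); the logarithmic derivative
   of the product gives D Delta = P Delta; hence Q^3 - R^2 = 1728 Delta.

   Power series are handled as polynomials modulo X^(n+1). Coefficients lie in
   an abstract realFieldType, as unification unfolds the arithmetic of rat. *)

(** * Sums over the positive solutions of a x + b y = n *)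

Lemma big_seq_bij (R : nmodType) (I J : eqType) (s : seq I) (t : seq J)
    (P : pred I) (Q : pred J) (f : I -> J) (g : J -> I) (F : J -> R) :
    uniq s -> uniq t ->
    (forall i, i \in s -> P i -> [/\ f i \in t, Q (f i) & g (f i) = i]) ->
    (forall j, j \in t -> Q j -> [/\ g j \in s, P (g j) & f (g j) = j]) ->
  \sum_(j <- t | Q j) F j = \sum_(i <- s | P i) F (f i).
Proof.
move=> Us Ut fP gP.
rewrite -big_filter -[RHS]big_filter -(big_map f xpredT).
apply/perm_big/uniq_perm; first by rewrite filter_uniq.
- rewrite map_inj_in_uniq ?filter_uniq // => i i'.
  rewrite !mem_filter => /andP[Pi si] /andP[Pi' si'] eqf.
  have [_ _ <-] := fP i si Pi; rewrite eqf.
  by have [_ _ ->] := fP i' si' Pi'.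
- move=> j; rewrite mem_filter; apply/andP/mapP => [[Qj tj]|[i]].
    by have [sg Pg <-] := gP j tj Qj; exists (g j); rewrite ?mem_filter ?Pg.
  by rewrite mem_filter => /andP[Pi si] ->; have [] := fP i si Pi.
Qed.

Arguments big_seq_bij {R I J s t P Q} f g {F}.

Local Notation quad := (nat * nat * nat * nat)%type.

(* [(a, b, x, y)] stands for the decomposition [n = a x + b y]. *)
Definition sols (n : nat) : seq quad :=
  [seq (ab.1, ab.2, (m %/ ab.1)%N, ((n - m) %/ ab.2)%N)
     | m <- index_iota 1 n,
       ab <- [seq (a, b) | a <- divisors m, b <- divisors (n - m)]].

Definition sol (n : nat) (t : quad) : bool :=
  let: (a, b, x, y) := t in
  [&& 0 < a, 0 < b, 0 < x, 0 < y & a * x + b * y == n]%N.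

Lemma mem_sols n t : (t \in sols n) = sol n t.
Proof.
apply/allpairsPdep/idP =>
  [[m [[_ _] [+ /allpairsP[[a b] [/= + + [-> ->]]] ->]]]|].
  rewrite mem_index_iota => /andP[m0 mn].
  rewrite -!dvdn_divisors ?subn_gt0 // => /dvdnP[x Ex] /dvdnP[y Ey] /=.
  have a0 : (0 < a)%N by nia.
  have b0 : (0 < b)%N by nia.
  by rewrite Ey {1 2}Ex !mulnK //; apply/and5P; split; nia.
case: t => [[[a b] x] y] /and5P[a0 b0 x0 y0 /eqP En].
exists (a * x)%N, (a, b).
have -> : (n - a * x = b * y)%N by lia.
rewrite !mulKn //; split=> //.
  by rewrite mem_index_iota; apply/andP; split; nia.
by apply/allpairsP; exists (a, b); rewrite -!dvdn_divisors ?dvdn_mulr //; nia.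
Qed.

Lemma sols_uniq n : uniq (sols n).
Proof.
rewrite allpairs_uniq_dep ?iota_uniq // => [m _|].
  by rewrite allpairs_uniq ?divisors_uniq // => -[? ?] [].
(* Each m is recovered from its image as a (m / a), because a divides m; hence the enumeration has
   no repetitions. *)
have inS u : u \in [seq existT (fun=> (nat * nat)%type) m ab
     | m <- index_iota 1 n,
       ab <- [seq (a, b) | a <- divisors m, b <- divisors (n - m)]] ->
     (tag u = (tagged u).1 * (tag u %/ (tagged u).1))%N.
  case/allpairsPdep => m [[a b] [+ /allpairsP[[a' b'] [/= + _ [-> _]]] ->]] /=.
  rewrite mem_index_iota => /andP[m0 _].
  by rewrite -dvdn_divisors // mulnC => /divnK->.
move=> [m [a b]] [m' [a' b']] /inS /= Em /inS /= Em' [Ea <- Ex _].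
by rewrite -Ea; have <- : m = m' by rewrite Em Ex Ea -Em'.
Qed.

Definition qa (t : quad) : nat := t.1.1.1.
Definition qb (t : quad) : nat := t.1.1.2.
Definition qx (t : quad) : nat := t.1.2.
Definition qy (t : quad) : nat := t.2.

Definition convol (j k n : nat) : nat :=
  \sum_(1 <= m < n) sigma j m * sigma k (n - m).

Lemma sum_trichotomy (R : nmodType) (I : Type) (s : seq I) (u v : I -> nat)
    (F : I -> R) :
  \sum_(i <- s) F i = \sum_(i <- s | (u i < v i)%N) F i
    + \sum_(i <- s | u i == v i) F i + \sum_(i <- s | (v i < u i)%N) F i.
Proof.
rewrite (bigID (fun i => u i < v i)%N) /= -addrA; congr (_ + _).
rewrite (bigID (fun i => u i == v i)) /=; congr (_ + _); apply: eq_bigl => i.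
  by case: ltngtP.
by case: ltngtP.
Qed.

Arguments sum_trichotomy {R I s} u v F.

Section SolutionSums.
Variables (R : nmodType) (n : nat).
Implicit Type F : quad -> R.

Lemma sum_sols_swap (P : pred quad) F :
  \sum_(t <- sols n | P t) F t =
  \sum_(t <- sols n | P (qb t, qa t, qy t, qx t)) F (qb t, qa t, qy t, qx t).
Proof.
by apply: (big_seq_bij (I := quad) (J := quad)
    (fun t => (qb t, qa t, qy t, qx t)) (fun t => (qb t, qa t, qy t, qx t)))
  => [||t|t]; rewrite ?sols_uniq // !mem_sols;
  move: t => [[[a b] x] y] /and5P[a0 b0 x0 y0 En] Pt; split=> //;
  apply/and5P; rewrite /= addnC.
Qed.

(* [a x + b y = (a + b) x + b (y - x)] *)
Lemma sum_sols_shear F :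
  \sum_(t <- sols n | (qb t < qa t)%N) F t =
  \sum_(t <- sols n | (qx t < qy t)%N)
     F (qa t + qb t, qb t, qx t, qy t - qx t)%N.
Proof.
apply: (big_seq_bij (I := quad) (J := quad)
    (fun t => (qa t + qb t, qb t, qx t, qy t - qx t)%N)
    (fun t => (qa t - qb t, qb t, qx t, qy t + qx t)%N))
  => [||t|t]; rewrite ?sols_uniq // !mem_sols;
  move: t => [[[a b] x] y] /and5P[a0 b0 x0 y0 /eqP En];
  rewrite /qa/qb/qx/qy /= => Pt; split=> //.
- apply/and5P; split; rewrite // ?addn_gt0 ?a0 ?subn_gt0 //.
  by apply/eqP; nia.
- by rewrite -{1}[b]add0n ltn_add2r.
- by rewrite addnK subnK // ltnW.
- apply/and5P; split; rewrite // ?addn_gt0 ?x0 ?subn_gt0 ?orbT //.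
  by apply/eqP; nia.
- by rewrite -{1}[x]add0n ltn_add2r.
- by rewrite addnK subnK // ltnW.
Qed.

(** If x = y then (a + b) x = n, so the solution amounts to a divisor d = a + b of n and some b with
    0 < b < d. *)
Lemma sum_sols_diag_xy (F : nat -> nat -> R) : (0 < n)%N ->
  \sum_(t <- sols n | qx t == qy t) F (qa t) (qb t) =
  \sum_(d <- divisors n) \sum_(1 <= b < d) F (d - b)%N b.
Proof.
move=> n0.
rewrite -(big_allpairs_dep (I2 := fun=> nat) (h := fun d b : nat => (d, b))
  (F := fun db : nat * nat => F (db.1 - db.2)%N db.2)).
apply: (big_seq_bij (J := quad) (P := xpredT) (F := fun t => F (qa t) (qb t))
    (fun db : nat * nat => (db.1 - db.2, db.2, n %/ db.1, n %/ db.1)%N)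
    (fun t => (qa t + qb t, qb t)%N)).
- rewrite allpairs_uniq_dep ?divisors_uniq // =>
    [d _|[? ?] [? ?] _ _ [-> ->]] //.
  exact: iota_uniq.
- exact: sols_uniq.
- move=> _ /allpairsPdep[d [b [+ + ->]]] _.
  rewrite -dvdn_divisors // mem_index_iota => /dvdnP[e En] /andP[b0 bd].
  have d0 : (0 < d)%N by lia.
  rewrite mem_sols /qa/qb/qx/qy /= subnK ?(ltnW bd) // En mulnK //; split=> //.
  by apply/and5P; split; rewrite ?subn_gt0 //; nia.
- move=> [[[a b] x] y]; rewrite mem_sols => /and5P[a0 b0 x0 y0 /eqP En].
  rewrite /qa/qb/qx/qy /= => /eqP xy; subst y.
  have -> : (n %/ (a + b) = x)%N by rewrite -En -mulnDl mulKn // addn_gt0 a0.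
  rewrite addnK; split=> //; apply/allpairsPdep; exists (a + b)%N, b.
  rewrite -dvdn_divisors // mem_index_iota b0 -{2}[b]add0n ltn_add2r a0.
  by rewrite -En -mulnDl dvdn_mulr.
Qed.

(** If a = b = d then d (x + y) = n, and x + y = n / d has n / d - 1 positive solutions. *)
Lemma sum_sols_diag_ab (G : nat -> R) : (0 < n)%N ->
  \sum_(t <- sols n | qa t == qb t) G (qb t) =
  \sum_(d <- divisors n) G d *+ (n %/ d - 1).
Proof.
move=> n0; under [RHS]eq_bigr do rewrite -sumr_const_nat.
rewrite -(big_allpairs_dep (I2 := fun=> nat) (h := fun d x : nat => (d, x))
  (F := fun dx : nat * nat => G dx.1)).
apply: (big_seq_bij (J := quad) (P := xpredT) (F := fun t => G (qb t))
    (fun dx : nat * nat => (dx.1, dx.1, dx.2, n %/ dx.1 - dx.2)%N)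
    (fun t => (qb t, qx t)%N)).
- rewrite allpairs_uniq_dep ?divisors_uniq // =>
    [d _|[? ?] [? ?] _ _ [-> ->]] //.
  exact: iota_uniq.
- exact: sols_uniq.
- move=> _ /allpairsPdep[d [x [+ + ->]]] _.
  rewrite -dvdn_divisors // mem_index_iota => /dvdnP[e En] /andP[x0].
  have d0 : (0 < d)%N by nia.
  rewrite mem_sols /qa/qb/qx/qy /= En mulnK // => xe; split=> //.
  apply/and5P; split; rewrite ?subn_gt0 //.
  by rewrite -mulnDr subnKC ?(ltnW xe) // mulnC.
- move=> [[[a b] x] y]; rewrite mem_sols => /and5P[a0 b0 x0 y0 /eqP En].
  rewrite /qa/qb/qx/qy /= => /eqP ab; subst b.
  have -> : (n %/ a = x + y)%N by rewrite -En -mulnDr mulKn.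
  rewrite addKn; split=> //; apply/allpairsPdep; exists a, x.
  rewrite -dvdn_divisors // mem_index_iota x0 -En -mulnDr mulKn //.
  by rewrite dvdn_mulr // -{1}[x]addn0 ltn_add2l.
Qed.

End SolutionSums.

Arguments sum_sols_shear {R n} F.
Arguments sum_sols_diag_xy {R n} F.
Arguments sum_sols_diag_ab {R n} G.

(** * Convolutions of divisor sums from Skoruppa's identity *)

Section ConvolutionSums.
Variable R : realFieldType.

(** With m = a x fixed, a runs over the divisors of m and b over those of n - m; [sols] is
    enumerated in this order. *)
Lemma convol_sols (j k n : nat) :
  (convol j k n)%:R = \sum_(t <- sols n) (qa t)%:R ^+ j * (qb t)%:R ^+ k :> R.
Proof.
rewrite natr_sum big_allpairs_dep; apply: eq_bigr => m _.
rewrite big_allpairs natrM /sigma !natr_sum mulr_suml; apply: eq_bigr => a _.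
by rewrite mulr_sumr; apply: eq_bigr => b _; rewrite !natrX.
Qed.

(* Skoruppa's identity. Both [p (a + b) b] and [p (a - b) b] are brought by the
   shear to sums of [p a b] over half-ranges; [p a b] being symmetric, its sums
   over [b < a] and over [x < y] are half of its total sum, up to the diagonals
   [a = b] and [x = y]. *)
Lemma sum_sols_even_sym (p : R -> R -> R) (n : nat) :
    (0 < n)%N ->
    (forall a b, p a b = p b a) -> (forall a b, p (- a) b = p a b) ->
  \sum_(t <- sols n) (p ((qa t)%:R + (qb t)%:R) (qb t)%:R
                      - p ((qa t)%:R - (qb t)%:R) (qb t)%:R) =
  \sum_(d <- divisors n)
     (\sum_(1 <= b < d) (p d%:R b%:R + p (d%:R - b%:R) b%:R / 2%:R)
      - ((n %/ d)%:R - 1) * (p 0 d%:R + p d%:R d%:R / 2%:R)).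
Proof.
move=> n0 pC pN.
pose A t : R := (qa t)%:R; pose B t : R := (qb t)%:R.
pose Sx (F : quad -> R) := \sum_(t <- sols n | (qx t < qy t)%N) F t.
pose Sa (F : quad -> R) := \sum_(t <- sols n | (qb t < qa t)%N) F t.
pose Dx (F : quad -> R) := \sum_(t <- sols n | qx t == qy t) F t.
pose Da (F : quad -> R) := \sum_(t <- sols n | qa t == qb t) F t.
have all_x F : \sum_(t <- sols n) F t =
    Sx F + Dx F + Sx (fun t => F (qb t, qa t, qy t, qx t)).
  by rewrite (sum_trichotomy qx qy) [X in _ + X]sum_sols_swap.
have all_a F : \sum_(t <- sols n) F t =
    Sa (fun t => F (qb t, qa t, qy t, qx t)) + Da F + Sa F.
  by rewrite (sum_trichotomy qa qb) [X in X + _ + _]sum_sols_swap.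
have shear (f : R -> R -> R) :
    Sa (fun t => f (A t) (B t)) = Sx (fun t => f (A t + B t) (B t)).
  rewrite /Sa /Sx (sum_sols_shear (fun t => f (A t) (B t))).
  by apply: eq_bigr => t _; rewrite /A /B /= natrD.
have eqDa (f g : R -> R -> R) : (forall b, f b b = g b b) ->
    Da (fun t => f (A t) (B t)) = Da (fun t => g (B t) (B t)).
  by move=> fg; apply: eq_bigr => t /eqP ab; rewrite /A ab.
have pB a b : p (a - b) b = p (b - a) b by rewrite -opprB pN.
have ES : \sum_(t <- sols n) p (A t) (B t) =
    2%:R * Sa (fun t => p (A t) (B t)) + Da (fun t => p (A t) (B t)).
  rewrite all_a [X in X + _ + _](_ : _ = Sa (fun t => p (A t) (B t))).
    by ring.
  by apply: eq_bigr => t _; rewrite pC.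
have ES' : \sum_(t <- sols n) p (A t) (B t) =
    2%:R * Sx (fun t => p (A t) (B t)) + Dx (fun t => p (A t) (B t)).
  rewrite all_x [X in _ + X](_ : _ = Sx (fun t => p (A t) (B t))).
    by ring.
  by apply: eq_bigr => t _; rewrite pC.
have EP : \sum_(t <- sols n) p (A t + B t) (B t) =
    Sa (fun t => p (A t) (B t)) + Dx (fun t => p (A t + B t) (B t))
      + Sx (fun t => p (A t + B t) (A t)).
  rewrite all_x shear; congr (_ + _).
  by apply: eq_bigr => t _; rewrite addrC.
(* The shear sends p (a - b) b on b < a to p a b on x < y. The swapped half becomes p (a + b) a by
   evenness and symmetry, and a = b contributes p 0 b. *)
have EM : \sum_(t <- sols n) p (A t - B t) (B t) =
    Sx (fun t => p (A t + B t) (A t)) + Da (fun t => p 0 (B t))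
      + Sx (fun t => p (A t) (B t)).
  rewrite all_a (shear (fun a b => p (a - b) b)).
  rewrite (eqDa (fun a b => p (a - b) b) (fun a b => p 0 b)); last first.
    by move=> b; rewrite subrr.
  congr (_ + _ + _); last by apply: eq_bigr => t _; rewrite addrK.
  rewrite [LHS](shear (fun a b => p (b - a) a)); apply: eq_bigr => t _.
  by rewrite pB addrK pC.
rewrite sumrB EP EM !sumrB /=.
have -> : \sum_(d <- divisors n) \sum_(1 <= b < d)
      (p d%:R b%:R + p (d%:R - b%:R) b%:R / 2%:R) =
    Dx (fun t => p (A t + B t) (B t)) + Dx (fun t => p (A t) (B t)) / 2%:R.
  rewrite /Dx mulr_suml -big_split /=.
  rewrite (sum_sols_diag_xy
    (fun a b => p (a%:R + b%:R) b%:R + p a%:R b%:R / 2%:R)) //.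
  apply: eq_bigr => d _; apply: eq_big_nat => b /andP[_ bd].
  by rewrite -natrD -natrB 1?ltnW // subnK // ltnW.
have -> : \sum_(d <- divisors n)
      ((n %/ d)%:R - 1) * (p 0 d%:R + p d%:R d%:R / 2%:R) =
    Da (fun t => p 0 (B t)) + Da (fun t => p (A t) (B t)) / 2%:R.
  rewrite (eqDa p p) // /Da mulr_suml -big_split /=.
  rewrite (sum_sols_diag_ab (fun b => p 0 b%:R + p b%:R b%:R / 2%:R)) //.
  apply: eq_big_seq => d; rewrite -dvdn_divisors // => dn.
  by rewrite -[RHS]mulr_natl natrB // divn_gt0 ?(dvdn_leq n0) ?(dvdn_gt0 n0).
(* The sum of p (a + b) a over x < y occurs in both [EP] and [EM] and cancels; [ES] and [ES'] turn
   what is left of the half-range sums into half the difference of the diagonals. *)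
lra.
Qed.

(* The antidifferences [G] in the evaluations below come from Faulhaber's
   formulas for [1 ^ k + ... + (m - 1) ^ k]. *)
Lemma telescope_sum_nat (g G : R -> R) (n : nat) :
    G 1 = 0 -> (forall m, G (m + 1) = G m + g m) ->
  (0 < n)%N -> \sum_(1 <= b < n) g b%:R = G n%:R.
Proof.
move=> G1 GS; elim: n => // -[|n] IHn _; first by rewrite big_geq ?mulr1n.
by rewrite big_nat_recr //= IHn // -GS natr1.
Qed.

Lemma sigmaE (k n : nat) :
  (sigma k n)%:R = \sum_(d <- divisors n) d%:R ^+ k :> R.
Proof. by rewrite natr_sum; apply: eq_bigr => d _; rewrite natrX. Qed.

(** Since (n / d) d = n, the factor n / d left by the diagonal a = b becomes a factor n, at the cost
    of one power of d. *)
Lemma sigma_mul_conj (k n : nat) : (0 < n)%N ->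
  \sum_(d <- divisors n) (n %/ d)%:R * d%:R ^+ k.+1
  = n%:R * (sigma k n)%:R :> R.
Proof.
move=> n0; rewrite sigmaE mulr_sumr.
apply: eq_big_seq => d; rewrite -dvdn_divisors // => dn.
by rewrite exprS mulrA -natrM divnK.
Qed.

Lemma convolC (j k n : nat) : convol j k n = convol k j n.
Proof.
apply/eqP; rewrite -(Num.Theory.eqr_nat R) !convol_sols sum_sols_swap.
by apply/eqP; apply: eq_bigr => t _; rewrite mulrC.
Qed.

(** For p = a^2 b^2 the difference p (a + b) b - p (a - b) b is 4 a b^3, so a single convolution
    appears. *)
Lemma convol13 (n : nat) : (0 < n)%N ->
  240%:R * (convol 1 3 n)%:R =
  21%:R * (sigma 5 n)%:R + (10%:R - 30%:R * n%:R) * (sigma 3 n)%:R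
    - (sigma 1 n)%:R :> R.
Proof.
move=> n0.
pose p (a b : R) : R :=
  a ^+ 2 * b ^+ 2.
have pC a b : p a b = p b a by rewrite /p; ring.
have pN a b : p (- a) b = p a b by rewrite /p; ring.
have := sum_sols_even_sym p n n0 pC pN.
rewrite [X in X = _ -> _](_ : _ = \sum_(t <- sols n)
      (4%:R * ((qa t)%:R ^+ 1 * (qb t)%:R ^+ 3))); last first.
  by apply: eq_bigr => t _; rewrite /p; ring.
(* The sum over b < d is the antidifference at m = d, grouped below by explicit powers of d. Its
   term - d^4 / 2 cancels against the diagonal a = b, of which only - (n / d) d^4 / 2 remains. *)
rewrite [X in _ = X -> _](_ : _ = \sum_(d <- divisors n)
      ((7%:R / 20%:R) * d%:R ^+ 5 + (1%:R / 6%:R) * d%:R ^+ 3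
       + (- (1%:R / 60%:R)) * d%:R ^+ 1
       + (- (1%:R / 2%:R)) * ((n %/ d)%:R * d%:R ^+ 4))); last first.
  apply: eq_big_seq => d; rewrite -dvdn_divisors // => dn.
  rewrite (telescope_sum_nat (fun b => p d%:R b + p (d%:R - b) b / 2%:R)
      (fun m =>
        d%:R ^+ 2 * (1%:R / 2%:R * m ^+ 3 - 3%:R / 4%:R * m ^+ 2
            + 1%:R / 4%:R * m)
        + d%:R * (- 1%:R / 4%:R * m ^+ 4 + 1%:R / 2%:R * m ^+ 3
            - 1%:R / 4%:R * m ^+ 2)
        + (1%:R / 10%:R * m ^+ 5 - 1%:R / 4%:R * m ^+ 4
            + 1%:R / 6%:R * m ^+ 3 - 1%:R / 60%:R * m)));
    last exact: dvdn_gt0 dn.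
  - by rewrite /p; field.
  - by field.
  - by move=> m; rewrite /p; field.
rewrite !big_split /= -!mulr_sumr -!convol_sols.
rewrite sigma_mul_conj // -!sigmaE; lra.
Qed.

(** This p gives a b^5 and a^5 b opposite coefficients, so their sums cancel by [convolC]. Moreover
    p 0 d + p d d / 2 = 0, so no term in n / d arises. *)
Lemma convol33 (n : nat) : (0 < n)%N ->
  120%:R * (convol 3 3 n)%:R =
  (sigma 7 n)%:R - (sigma 3 n)%:R :> R.
Proof.
move=> n0.
pose p (a b : R) : R :=
  2%:R * (a ^+ 4 * b ^+ 2 + a ^+ 2 * b ^+ 4) - (a ^+ 6 + b ^+ 6).
have pC a b : p a b = p b a by rewrite /p; ring.
have pN a b : p (- a) b = p a b by rewrite /p; ring.
have := sum_sols_even_sym p n n0 pC pN.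
rewrite [X in X = _ -> _](_ : _ = \sum_(t <- sols n)
      ((- 24%:R) * ((qa t)%:R ^+ 3 * (qb t)%:R ^+ 3)
       + 12%:R * ((qa t)%:R ^+ 1 * (qb t)%:R ^+ 5)
       + (- 12%:R) * ((qa t)%:R ^+ 5 * (qb t)%:R ^+ 1))); last first.
  by apply: eq_bigr => t _; rewrite /p; ring.
rewrite [X in _ = X -> _](_ : _ = \sum_(d <- divisors n)
      ((- (1%:R / 5%:R)) * d%:R ^+ 7 + (1%:R / 5%:R) * d%:R ^+ 3)); last first.
  apply: eq_big_seq => d; rewrite -dvdn_divisors // => dn.
  rewrite (telescope_sum_nat (fun b => p d%:R b + p (d%:R - b) b / 2%:R)
      (fun m =>
        d%:R ^+ 6 * (- 3%:R / 2%:R * m + 3%:R / 2%:R)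
        + d%:R ^+ 5 * (3%:R / 2%:R * m ^+ 2 - 3%:R / 2%:R * m)
        + d%:R ^+ 4 * (- 3%:R / 2%:R * m ^+ 3 + 9%:R / 4%:R * m ^+ 2
            - 3%:R / 4%:R * m)
        + d%:R ^+ 3 * (3%:R / 2%:R * m ^+ 4 - 3%:R * m ^+ 3
            + 3%:R / 2%:R * m ^+ 2)
        + d%:R ^+ 2 * (3%:R / 10%:R * m ^+ 5 - 3%:R / 4%:R * m ^+ 4
            + 1%:R / 2%:R * m ^+ 3 - 1%:R / 20%:R * m)
        + d%:R * (- 1%:R / 2%:R * m ^+ 6 + 3%:R / 2%:R * m ^+ 5
            - 5%:R / 4%:R * m ^+ 4 + 1%:R / 4%:R * m ^+ 2)));
    last exact: dvdn_gt0 dn.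
  - by rewrite /p; field.
  - by field.
  - by move=> m; rewrite /p; field.
rewrite !big_split /= -!mulr_sumr -!convol_sols.
rewrite -!sigmaE (convolC 5 1); lra.
Qed.

(** This p produces a^3 b^3 next to a b^5; the former is eliminated by [convol33]. *)
Lemma convol15 (n : nat) : (0 < n)%N ->
  504%:R * (convol 1 5 n)%:R =
  20%:R * (sigma 7 n)%:R + (21%:R - 42%:R * n%:R) * (sigma 5 n)%:R
    + (sigma 1 n)%:R :> R.
Proof.
move=> n0.
pose p (a b : R) : R :=
  a ^+ 4 * b ^+ 2 + a ^+ 2 * b ^+ 4.
have pC a b : p a b = p b a by rewrite /p; ring.
have pN a b : p (- a) b = p a b by rewrite /p; ring.
have := sum_sols_even_sym p n n0 pC pN.
rewrite [X in X = _ -> _](_ : _ = \sum_(t <- sols n)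
      (8%:R * ((qa t)%:R ^+ 3 * (qb t)%:R ^+ 3)
       + 12%:R * ((qa t)%:R ^+ 1 * (qb t)%:R ^+ 5))); last first.
  by apply: eq_bigr => t _; rewrite /p; ring.
rewrite [X in _ = X -> _](_ : _ = \sum_(d <- divisors n)
      ((19%:R / 35%:R) * d%:R ^+ 7 + (1%:R / 2%:R) * d%:R ^+ 5
       + (- (1%:R / 15%:R)) * d%:R ^+ 3 + (1%:R / 42%:R) * d%:R ^+ 1
       + (- 1%:R) * ((n %/ d)%:R * d%:R ^+ 6))); last first.
  apply: eq_big_seq => d; rewrite -dvdn_divisors // => dn.
  rewrite (telescope_sum_nat (fun b => p d%:R b + p (d%:R - b) b / 2%:R)
      (fun m =>
        d%:R ^+ 4 * (1%:R / 2%:R * m ^+ 3 - 3%:R / 4%:R * m ^+ 2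
            + 1%:R / 4%:R * m)
        + d%:R ^+ 3 * (- 1%:R / 2%:R * m ^+ 4 + m ^+ 3
            - 1%:R / 2%:R * m ^+ 2)
        + d%:R ^+ 2 * (9%:R / 10%:R * m ^+ 5 - 9%:R / 4%:R * m ^+ 4
            + 3%:R / 2%:R * m ^+ 3 - 3%:R / 20%:R * m)
        + d%:R * (- 1%:R / 2%:R * m ^+ 6 + 3%:R / 2%:R * m ^+ 5
            - 5%:R / 4%:R * m ^+ 4 + 1%:R / 4%:R * m ^+ 2)
        + (1%:R / 7%:R * m ^+ 7 - 1%:R / 2%:R * m ^+ 6
            + 1%:R / 2%:R * m ^+ 5 - 1%:R / 6%:R * m ^+ 3
            + 1%:R / 42%:R * m)));
    last exact: dvdn_gt0 dn.
  - by rewrite /p; field.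
  - by field.
  - by move=> m; rewrite /p; field.
rewrite !big_split /= -!mulr_sumr -!convol_sols.
rewrite sigma_mul_conj // -!sigmaE; have := convol33 n n0; lra.
Qed.

(** Each of the two convolutions alone involves tau; this combination does not. As p 0 d and p d d
    vanish, there is no term in n / d either. *)
Lemma convol37_55 (n : nat) : (0 < n)%N ->
  504%:R * (convol 3 7 n)%:R + 630%:R * (convol 5 5 n)%:R =
  (13%:R * (sigma 11 n)%:R - 42%:R * (sigma 7 n)%:R + 50%:R * (sigma 5 n)%:R
    - 21%:R * (sigma 3 n)%:R) / 20%:R :> R.
Proof.
move=> n0.
pose p (a b : R) : R :=
  (* The monomials [a ^+ 9 * b] and [a * b ^+ 9] cancel for this [p]. *)
  a ^+ 8 * b ^+ 2 + a ^+ 2 * b ^+ 8 - (a ^+ 6 * b ^+ 4 + a ^+ 4 * b ^+ 6).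
have pC a b : p a b = p b a by rewrite /p; ring.
have pN a b : p (- a) b = p a b by rewrite /p; ring.
have := sum_sols_even_sym p n n0 pC pN.
rewrite [X in X = _ -> _](_ : _ = \sum_(t <- sols n)
      (16%:R * ((qa t)%:R ^+ 7 * (qb t)%:R ^+ 3)
       + 64%:R * ((qa t)%:R ^+ 3 * (qb t)%:R ^+ 7)
       + 100%:R * ((qa t)%:R ^+ 5 * (qb t)%:R ^+ 5))); last first.
  by apply: eq_bigr => t _; rewrite /p; ring.
rewrite [X in _ = X -> _](_ : _ = \sum_(d <- divisors n)
      ((13%:R / 126%:R) * d%:R ^+ 11 + (- (1%:R / 3%:R)) * d%:R ^+ 7
       + (25%:R / 63%:R) * d%:R ^+ 5 + (- (1%:R / 6%:R)) * d%:R ^+ 3));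
  last first.
  apply: eq_big_seq => d; rewrite -dvdn_divisors // => dn.
  rewrite (telescope_sum_nat (fun b => p d%:R b + p (d%:R - b) b / 2%:R)
      (fun m =>
        d%:R ^+ 8 * (1%:R / 2%:R * m ^+ 3 - 3%:R / 4%:R * m ^+ 2
            + 1%:R / 4%:R * m)
        + d%:R ^+ 7 * (- m ^+ 4 + 2%:R * m ^+ 3 - m ^+ 2)
        + d%:R ^+ 6 * (5%:R / 2%:R * m ^+ 5 - 25%:R / 4%:R * m ^+ 4
            + 25%:R / 6%:R * m ^+ 3 - 5%:R / 12%:R * m)
        + d%:R ^+ 5 * (- 25%:R / 6%:R * m ^+ 6 + 25%:R / 2%:R * m ^+ 5
            - 125%:R / 12%:R * m ^+ 4 + 25%:R / 12%:R * m ^+ 2)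
        + d%:R ^+ 4 * (26%:R / 7%:R * m ^+ 7 - 13%:R * m ^+ 6
            + 13%:R * m ^+ 5 - 13%:R / 3%:R * m ^+ 3 + 13%:R / 21%:R * m)
        + d%:R ^+ 3 * (- 2%:R * m ^+ 8 + 8%:R * m ^+ 7
            - 28%:R / 3%:R * m ^+ 6 + 14%:R / 3%:R * m ^+ 4
            - 4%:R / 3%:R * m ^+ 2)
        + d%:R ^+ 2 * (5%:R / 9%:R * m ^+ 9 - 5%:R / 2%:R * m ^+ 8
            + 10%:R / 3%:R * m ^+ 7 - 7%:R / 3%:R * m ^+ 5
            + 10%:R / 9%:R * m ^+ 3 - 1%:R / 6%:R * m)));
    last exact: dvdn_gt0 dn.
  - by rewrite /p; field.
  - by field.
  - by move=> m; rewrite /p; field.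
rewrite !big_split /= -!mulr_sumr -!convol_sols.
rewrite -!sigmaE (convolC 7 3); lra.
Qed.

End ConvolutionSums.

(** * Polynomials modulo X^N as truncated series, and the Euler operator *)

Section TruncatedSeries.
Variable R : realFieldType.
Implicit Types p q f g : {poly R}.

Lemma dvdXnP (N : nat) p :
  reflect (forall i, (i < N)%N -> p`_i = 0) ('X^N %| p).
Proof.
rewrite /dvdp -Pdiv.IdomainMonic.take_poly_modp.
apply: (iffP eqP) => [p0 i iN | p0].
  by have := coef_take_poly N p i; rewrite p0 coef0 iN.
by apply/polyP=> i; rewrite coef_take_poly coef0; case: ifP => // /p0.
Qed.

(* The Euler operator [q d/dq]. *)
Definition euler p : {poly R} := 'X * p^`().

Lemma coef_euler p i : (euler p)`_i = i%:R * p`_i.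
Proof. by rewrite coefXM coef_deriv mulr_natl; case: i. Qed.

Lemma eulerD p q : euler (p + q) = euler p + euler q.
Proof. by rewrite /euler derivD mulrDr. Qed.

Lemma eulerN p : euler (- p) = - euler p.
Proof. by rewrite /euler derivN mulrN. Qed.

Lemma eulerM p q : euler (p * q) = euler p * q + p * euler q.
Proof. by rewrite /euler derivM; ring. Qed.

Lemma euler_nat (n : nat) : euler n%:R = 0.
Proof. by rewrite /euler -polyC_natr derivC mulr0. Qed.

Lemma dvdXn_euler (N : nat) p : 'X^N %| p -> 'X^N %| euler p.
Proof.
by move=> /dvdXnP p0; apply/dvdXnP => i iN; rewrite coef_euler p0 ?mulr0.
Qed.

Lemma coefM_interior p q n : p`_0 = 0 -> q`_0 = 0 ->
  (p * q)`_n = \sum_(1 <= m < n) p`_m * q`_(n - m).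
Proof.
move=> p0 q0; rewrite coefM -(big_mkord xpredT (fun m => p`_m * q`_(n - m))).
rewrite big_ltn // p0 mul0r add0r; case: n => [|n]; first by rewrite !big_geq.
by rewrite big_nat_recr //= subnn q0 mulr0 addr0.
Qed.

(** As p has constant term 1, coefficient i of the equation reads (i - 1) f_i = a combination of
    earlier f_j. Induction gives f_i = 0 except at i = 1, where it is assumed. *)
Lemma euler_eigen_unique (N : nat) p f : p`_0 = 1 -> f`_1 = 0 ->
  'X^N %| euler f - p * f -> 'X^N %| f.
Proof.
move=> p0 f1 /dvdXnP eqf; apply/dvdXnP; elim/ltn_ind => i IHi iN.
have := eqf i iN; rewrite coefB coef_euler coefM big_ord_recl /= p0 subn0 mul1r.
rewrite big1 ?addr0 => [|j _]; last first.
  by rewrite IHi ?mulr0 //= /bump; have := ltn_ord j; lia.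
have [->|i1] := eqVneq i 1%N; first by rewrite f1.
rewrite -{2}[f`_i]mul1r -mulrBl => /eqP; rewrite mulf_eq0 => /orP[|/eqP //].
by rewrite subr_eq0 Num.Theory.pnatr_eq1 (negbTE i1).
Qed.

(** Logarithmic derivatives add up under products; writing D f = g f instead of D f / f = g avoids
    division. *)
Lemma euler_prod_log (I : Type) (s : seq I) (M : {poly R})
    (f g : I -> {poly R}) :
    (forall k, M %| euler (f k) - g k * f k) ->
  M %| euler (\prod_(k <- s) f k) - (\sum_(k <- s) g k) * \prod_(k <- s) f k.
Proof.
move=> fg; elim: s => [|k s IHs].
  by rewrite !big_nil -[1]/1%:R euler_nat mul0r subrr dvdp0.
rewrite !big_cons eulerM.
set F := \prod_(_ <- _) _ in IHs *; set G := \sum_(_ <- _) _ in IHs *.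
rewrite (_ : _ - _ = F * (euler (f k) - g k * f k) + f k * (euler F - G * F));
  last by ring.
by rewrite dvdp_add // dvdp_mull.
Qed.

Lemma geometric_sum (y : {poly R}) (N : nat) :
  (1 - y) * \sum_(1 <= j < N.+1) y ^+ j = y - y ^+ N.+1.
Proof.
elim: N => [|N IHN]; first by rewrite big_geq // mulr0 expr1 subrr.
by rewrite big_nat_recr //= mulrDr IHN [y ^+ N.+2]exprS; ring.
Qed.

(** The factor [*+ (0 < i)] makes the constant term 0, whatever value [sigma k 0] takes. *)
Definition sigma_series (k N : nat) : {poly R} :=
  \poly_(i < N) ((sigma k i)%:R *+ (0 < i)%N).

Lemma coef_sigma_series k N i : (0 < i < N)%N ->
  (sigma_series k N)`_i = (sigma k i)%:R.
Proof. by case/andP=> i0 iN; rewrite coef_poly iN i0. Qed.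

Lemma coef0_sigma_series k N : (sigma_series k N)`_0 = 0.
Proof. by rewrite coef_poly mulr0n if_same. Qed.

Lemma coefM_sigma_series j k N i : (i < N)%N ->
  (sigma_series j N * sigma_series k N)`_i = (convol j k i)%:R.
Proof.
move=> iN; rewrite coefM_interior ?coef0_sigma_series // natr_sum.
apply: eq_big_nat => m /andP[m0 mi].
by rewrite !coef_sigma_series ?natrM //; lia.
Qed.

End TruncatedSeries.

(** * Logarithmic derivative of the product defining Delta *)

Section DeltaSeries.
Variables (R : realFieldType) (n : nat).

Definition delta_series : {poly R} := map_poly intr (delta_trunc n).

Lemma delta_seriesE :
  delta_series = 'X * \prod_(1 <= k < n.+1) (1 - 'X^k) ^+ 24.
Proof.
rewrite /delta_series rmorphM rmorph_prod /= map_polyX; congr (_ * _).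
by apply: eq_bigr => k _; rewrite rmorphXn rmorphB rmorph1 /= map_polyXn.
Qed.

Lemma coef_delta_series i : (i <= n)%N -> delta_series`_i = (tau i)%:~R.
Proof. by move=> le_in; rewrite coef_map coef_delta_trunc. Qed.

Lemma tau1 : tau 1 = 1.
Proof.
by rewrite /tau /delta_trunc big_nat1 coefXM /= -horner_coef0 !hornerE.
Qed.

(** The range of k is the same for all i up to n, which allows a comparison with the Lambert series
    term by term in k. *)
Lemma sum_divisors_filter (i : nat) : (0 < i <= n)%N ->
  sigma 1 i = (\sum_(1 <= k < n.+1 | k %| i) k)%N.
Proof.
case/andP=> i0 le_in; rewrite /sigma -[RHS]big_filter.
under [LHS]eq_bigr do rewrite expn1.
apply/perm_big/uniq_perm => [||d];
  rewrite ?filter_uniq ?iota_uniq ?divisors_uniq //.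
rewrite mem_filter mem_index_iota -dvdn_divisors //.
apply/esym/andb_idr => di.
by rewrite (dvdn_gt0 i0 di) ltnS (leq_trans (dvdn_leq i0 di)).
Qed.

(* [q d/dq log (1 - q^k) = - k (q^k + q^2k + ...)] *)
Lemma sum_lambert :
  'X^(n.+1) %| \sum_(1 <= k < n.+1) k%:R * \sum_(1 <= j < n.+1) 'X^k ^+ j
             - sigma_series R 1 n.+1.
Proof.
apply/dvdXnP => i iN; rewrite coefB coef_sum.
have [->|i0] := posnP i.
  rewrite coef0_sigma_series subr0 big1_seq // => k.
  rewrite mem_index_iota => /andP[_ /andP[k0 _]].
  rewrite mulr_natl coefMn coef_sum big1_seq ?mul0rn // => j.
  rewrite mem_index_iota => /andP[_ /andP[j0 _]].
  by rewrite -exprM coefXn; case: eqP => // jk; lia.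
rewrite coef_sigma_series ?i0 // sum_divisors_filter ?i0 // natr_sum.
rewrite [X in _ - X]big_mkcond; apply/eqP; rewrite subr_eq0; apply/eqP.
apply: eq_big_nat => k /andP[k0 kn].
rewrite mulr_natl coefMn coef_sum.
under eq_bigr do rewrite -exprM coefXn.
(* The power X^i occurs among the X^(k j) only if k divides i, and then once, at j = i / k, which is
   at most n. *)
case: ifP => [/dvdnP[e Ei] | ki].
  have e_range : e \in index_iota 1 n.+1 by rewrite mem_index_iota; nia.
  rewrite (bigD1_seq e) ?iota_uniq //= Ei mulnC eqxx big1 ?addr0 // => j je.
  by rewrite eqn_pmul2l // eq_sym (negbTE je).
rewrite big1 ?mul0rn // => j _; case: eqP => // Ei.
by rewrite Ei dvdn_mulr in ki.
Qed.

(** D Delta = P Delta: the factor X contributes 1 to the logarithmic derivative, and the 24th powers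
    contribute -24 times the Lambert series. *)
Lemma euler_delta_series :
  'X^(n.+1) %| euler R delta_series
             - (1 - 24%:R * sigma_series R 1 n.+1) * delta_series.
Proof.
rewrite delta_seriesE; set Pi := \prod_(_ <- _) _.
pose G k : {poly R} := \sum_(1 <= j < n.+1) 'X^k ^+ j.
have dPi : 'X^(n.+1) %| euler R Pi
    - (\sum_(1 <= k < n.+1) - 24%:R * (k%:R * G k)) * Pi.
  apply: euler_prod_log => k.
  have eulerXn : euler R 'X^k = k%:R * 'X^k.
    apply/polyP => i; rewrite coef_euler [k%:R * 'X^k]mulr_natl coefMn coefXn.
    by case: eqP => [->|_]; rewrite ?mulr0 ?mul0rn ?mulr1.
  (* This is the error of the truncated geometric sum. For k = 0 the power is 1 and the factor k
     makes it vanish. *)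
  have dk : 'X^(n.+1) %| k%:R * ('X^k ^+ n.+1 : {poly R}).
    case: k {eulerXn} => [|k]; first by rewrite mul0r dvdp0.
    by rewrite -exprM mulSn exprD dvdp_mull // dvdp_mulr.
  have := geometric_sum R 'X^k n; rewrite -/(G k) => geo.
  have -> : euler R ((1 - 'X^k) ^+ 24) =
      - 24%:R * (1 - 'X^k) ^+ 23 * (k%:R * 'X^k).
    rewrite -eulerXn /euler deriv_exp derivB -mulr_natl.
    by rewrite (derivC 1); ring.
  rewrite (_ : _ - _ =
    - 24%:R * (1 - 'X^k) ^+ 23 * (k%:R * ('X^k - (1 - 'X^k) * G k)));
    last by ring.
  by rewrite geo dvdp_mull // opprB addrC subrK.
rewrite -mulr_sumr in dPi.
have := sum_lambert; rewrite -/(G _); set L := \sum_(1 <= k < n.+1) _ in dPi *.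
move=> dL; rewrite eulerM (_ : euler R 'X = 'X);
  last by rewrite /euler derivX mulr1.
rewrite (_ : _ - _ = 'X * (euler R Pi - (- 24%:R * L) * Pi)
  - 24%:R * 'X * Pi * (L - sigma_series R 1 n.+1)); last by ring.
by rewrite dvdp_sub ?dvdp_mull.
Qed.

End DeltaSeries.

Lemma coef_natM (R : nzRingType) (c : nat) (f : {poly R}) i :
  (c%:R * f)`_i = c%:R * f`_i.
Proof. by rewrite !mulr_natl coefMn. Qed.

(** * Relations between Eisenstein series modulo X^(n+1) *)

Section EisensteinRelations.
Variables (R : realFieldType) (n : nat).

Let N := n.+1.
Let s k : {poly R} := sigma_series R k N.
Let D := euler R.
Let P : {poly R} := 1 - 24%:R * s 1.
Let Q : {poly R} := 1 + 240%:R * s 3.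
Let E6 : {poly R} := 1 - 504%:R * s 5.
Let E8 : {poly R} := 1 + 480%:R * s 7.

Opaque sigma_series euler.

(** Coefficientwise this is [convol13], with multiplication by i written as D; degree 0, which
    [convol13] excludes, is checked apart. The next three lemmas follow the same pattern. *)
Lemma sigma_series13 : 'X^N %|
  240%:R * (s 1 * s 3) - (21%:R * s 5 + 10%:R * s 3 - 30%:R * D (s 3) - s 1).
Proof.
apply/dvdXnP => i iN.
rewrite coefB [X in _ - X]coefB [X in _ - (X - _)]coefB coefD.
rewrite !coef_natM coef_euler.
rewrite coefM_sigma_series //; have [->|i0] := posnP i.
  by rewrite /convol big_geq // !coef0_sigma_series; ring.
by rewrite convol13 // !coef_sigma_series ?i0 //; ring.
Qed.

Lemma sigma_series33 : 'X^N %| 120%:R * (s 3 * s 3) - (s 7 - s 3).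
Proof.
apply/dvdXnP => i iN.
rewrite coefB [X in _ - X]coefB !coef_natM coefM_sigma_series //.
have [->|i0] := posnP i.
  by rewrite /convol big_geq // !coef0_sigma_series; ring.
by rewrite convol33 // !coef_sigma_series ?i0 //; ring.
Qed.

Lemma sigma_series15 : 'X^N %|
  504%:R * (s 1 * s 5) - (20%:R * s 7 + 21%:R * s 5 - 42%:R * D (s 5) + s 1).
Proof.
apply/dvdXnP => i iN.
rewrite coefB [X in _ - X]coefD [X in _ - (X + _)]coefB coefD.
rewrite !coef_natM coef_euler.
rewrite coefM_sigma_series //; have [->|i0] := posnP i.
  by rewrite /convol big_geq // !coef0_sigma_series; ring.
by rewrite convol15 // !coef_sigma_series ?i0 //; ring.
Qed.

Lemma sigma_series37_55 : 'X^N %|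
  20%:R * (504%:R * (s 3 * s 7) + 630%:R * (s 5 * s 5))
  - (13%:R * s 11 - 42%:R * s 7 + 50%:R * s 5 - 21%:R * s 3).
Proof.
apply/dvdXnP => i iN.
rewrite coefB [X in _ - X]coefB [X in _ - (X - _)]coefD.
rewrite [X in _ - (X + _ - _)]coefB !coef_natM coefD !coef_natM.
rewrite !coefM_sigma_series //.
have [->|i0] := posnP i.
  by rewrite /convol !big_geq // !coef0_sigma_series; ring.
by rewrite convol37_55 // !coef_sigma_series ?i0 //; field.
Qed.

(** Ramanujan's differential equation for Q: once P Q is expanded, the dividend is 24 times that of
    [sigma_series13]. *)
Lemma eulerQ : 'X^N %| 3%:R * D Q - (P * Q - E6).
Proof.
rewrite /D /Q eulerD eulerM -[1]/1%:R !euler_nat.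
have := dvdp_mull 24%:R sigma_series13.
by congr (is_true (_ %| _)); rewrite /P /E6 /D; ring.
Qed.

Lemma eulerE6 : 'X^N %| 2%:R * D E6 - (P * E6 - E8).
Proof.
rewrite /D /E6 eulerD eulerN eulerM -[1]/1%:R !euler_nat.
have := dvdp_mull (- 24%:R) sigma_series15.
by congr (is_true (_ %| _)); rewrite /P /E8 /D; ring.
Qed.

Lemma E8_Q : 'X^N %| E8 - Q * Q.
Proof.
have := dvdp_mull (- 480%:R) sigma_series33.
by congr (is_true (_ %| _)); rewrite /E8 /Q; ring.
Qed.

(** The subtracted series is 691 E12, as E12 = 1 + (65520 / 691) s_11 and 65520 = 720 * 91. *)
Lemma weight12 : 'X^N %|
  441%:R * (Q * E8) + 250%:R * (E6 * E6) - (691%:R + 720%:R * (91%:R * s 11)).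
Proof.
have := dvdp_mull (20%:R * 252%:R) sigma_series37_55.
by congr (is_true (_ %| _)); rewrite /E8 /Q /E6; ring.
Qed.

Let F : {poly R} := Q * Q * Q - E6 * E6.

(** D F = 3 Q^2 DQ - 2 R DR = Q^2 (P Q - R) - R (P R - E8), and the terms without P cancel because
    E8 = Q^2. *)
Lemma euler_discriminant : 'X^N %| D F - P * F.
Proof.
have := dvdp_mull (Q * Q) eulerQ; have := dvdp_mull (- E6) eulerE6.
have := dvdp_mull E6 E8_Q => h1 h2 h3.
have := dvdp_add (dvdp_add h1 h2) h3.
congr (is_true (_ %| _)).
by rewrite /F /D (eulerD R (Q * Q * Q)) eulerN !eulerM; ring.
Qed.

(** Both F and 1728 Delta solve D f = P f, so it suffices that their coefficients of X agree. *)
Lemma discriminant_delta : (0 < n)%N ->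
  'X^N %| F - 1728%:R * delta_series R n.
Proof.
move=> n0; apply: (euler_eigen_unique R N P).
- by rewrite coefB coef1 coef_natM coef0_sigma_series mulr0 subr0.
- have c0 k : (s k)`_0 = 0 by exact: coef0_sigma_series.
  have c1 k : (s k)`_1 = 1.
    rewrite coef_sigma_series ?ltnS //.
    by rewrite /sigma (_ : divisors 1 = [:: 1%N]) // big_seq1 exp1n.
  have coef1M (p q : {poly R}) : (p * q)`_1 = p`_0 * q`_1 + p`_1 * q`_0.
    by rewrite coefM big_ord_recl big_ord1.
  (* The coefficient of X in F is 3 * 240 + 2 * 504 = 1728. *)
  rewrite !coefB coef_natM coef_delta_series // tau1 !coef1M !coef0M.
  rewrite /Q /E6 !coefD !coefN !coef_natM !c0 !c1 !coef1 /=; ring.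
rewrite (_ : _ - _ = D F - P * F
    - 1728%:R * (D (delta_series R n) - P * delta_series R n)); last first.
  by rewrite /D (eulerD R F) eulerN eulerM euler_nat; ring.
by rewrite dvdp_sub ?euler_discriminant // dvdp_mull // euler_delta_series.
Qed.

(** Split 691 = 441 + 250: replace Q^3 by Q E8 in the first part and by R^2 + 1728 Delta in the
    second, then apply [weight12]. Here 250 * 1728 = 720 * 600. *)
Lemma cubeQ : (0 < n)%N ->
  'X^N %| 691%:R * (Q * Q * Q)
          - (691%:R + 720%:R * (91%:R * s 11 + 600%:R * delta_series R n)).
Proof.
move=> n0; have := dvdp_mull 250%:R (discriminant_delta n0).
have := dvdp_mull (- 441%:R * Q) E8_Q => h1 h2.
have := dvdp_add (dvdp_add h1 h2) weight12.
by congr (is_true (_ %| _)); rewrite /F; ring.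
Qed.

Lemma euler_cubeQ : (0 < n)%N ->
  'X^N %| 691%:R * D (Q * Q * Q)
          - 720%:R * (91%:R * D (s 11) + 600%:R * D (delta_series R n)).
Proof.
move=> n0; have := dvdXn_euler _ _ _ (cubeQ n0).
congr (is_true (_ %| _)); rewrite [LHS](eulerD R (691%:R * (Q * Q * Q))) eulerN.
rewrite (eulerM R 691%:R) (eulerD R 691%:R) (eulerM R 720%:R).
by rewrite (eulerD R (91%:R * s 11)) (eulerM R 91%:R) (eulerM R 600%:R);
  rewrite !euler_nat /D; ring.
Qed.

(** The coefficient of X^n in D(Q^3) = 3 Q^2 DQ = 3 E8 DQ; both sides share the factor 720 = 3 *
    240, which is cancelled. *)
Lemma tau_convol_l : (0 < n)%N ->
  n%:R * (91%:R * (sigma 11 n)%:R + 600%:R * (tau n)%:~R) =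
  691%:R * (n%:R * (sigma 3 n)%:R + 480%:R *
     \sum_(1 <= m < n) m%:R * (sigma 3 m)%:R * (sigma 7 (n - m)%N)%:R) :> R.
Proof.
move=> n0; have DQ : D Q = 240%:R * D (s 3).
  by rewrite /D /Q eulerD eulerM -[1]/1%:R !euler_nat; ring.
have : 'X^N %| 720%:R * (691%:R * (D (s 3) + 480%:R * (D (s 3) * s 7))
    - (91%:R * D (s 11) + 600%:R * D (delta_series R n))).
  have := dvdp_add (dvdp_mull (691%:R * (3%:R * D Q)) E8_Q) (euler_cubeQ n0).
  by congr (is_true (_ %| _)); rewrite /D !(eulerM R) -/D DQ /E8; ring.
move/dvdXnP => /(_ n (ltnSn n)) /eqP.
rewrite coef_natM mulf_eq0 Num.Theory.pnatr_eq0 orFb coefB subr_eq0 => /eqP.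
rewrite coef_natM !coefD !coef_natM (coefM_interior R (D (s 3)) (s 7));
  rewrite ?coef_euler ?coef0_sigma_series ?mulr0 //.
rewrite coef_delta_series // !coef_sigma_series ?n0 ?leqnn // => eqn.
rewrite mulrDr [n%:R * (91%:R * _)]mulrCA [n%:R * (600%:R * _)]mulrCA -eqn.
congr (_ * (_ + _ * _)); apply: eq_big_nat => m /andP[m0 mn].
by rewrite coef_euler !coef_sigma_series //; lia.
Qed.

(** Since D E8 = 2 Q DQ, one has 3 Q D E8 = 2 D(Q^3); the common factor is now 1440 = 3 * 480. *)
Lemma tau_convol_r : (0 < n)%N ->
  n%:R * (91%:R * (sigma 11 n)%:R + 600%:R * (tau n)%:~R) =
  691%:R * (n%:R * (sigma 7 n)%:R + 240%:R *
     \sum_(1 <= m < n)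
        (n - m)%N%:R * (sigma 3 m)%:R * (sigma 7 (n - m)%N)%:R) :> R.
Proof.
move=> n0; have DE8 : D E8 = 480%:R * D (s 7).
  by rewrite /D /E8 eulerD eulerM -[1]/1%:R !euler_nat; ring.
have : 'X^N %| 1440%:R * (691%:R * (D (s 7) + 240%:R * (s 3 * D (s 7)))
    - (91%:R * D (s 11) + 600%:R * D (delta_series R n))).
  have := dvdp_mull (691%:R * (3%:R * Q)) (dvdXn_euler _ _ _ E8_Q).
  move=> /dvdp_add/(_ (dvdp_mull 2%:R (euler_cubeQ n0))).
  congr (is_true (_ %| _)).
  by rewrite (eulerD R E8) eulerN /D !(eulerM R) -/D DE8 /Q; ring.
move/dvdXnP => /(_ n (ltnSn n)) /eqP.
rewrite coef_natM mulf_eq0 Num.Theory.pnatr_eq0 orFb coefB subr_eq0 => /eqP.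
rewrite coef_natM !coefD !coef_natM (coefM_interior R (s 3) (D (s 7)));
  rewrite ?coef_euler ?coef0_sigma_series ?mulr0 //.
rewrite coef_delta_series // !coef_sigma_series ?n0 ?leqnn // => eqn.
rewrite mulrDr [n%:R * (91%:R * _)]mulrCA [n%:R * (600%:R * _)]mulrCA -eqn.
congr (_ * (_ + _ * _)); apply: eq_big_nat => m /andP[m0 mn].
rewrite coef_euler !coef_sigma_series; [by ring|lia|lia].
Qed.

End EisensteinRelations.

(** * Solving for tau over the rationals *)

Lemma convol_identity_solve (R : realFieldType) (c x m a b S : R) : m != 0 ->
    m * (91%:R * a + 600%:R * x) = 691%:R * (m * b + 120%:R * c * S) ->
  x = - (91%:R / 600%:R) * a + (691%:R / 600%:R) * b
      + (c * 691%:R) / (5%:R * m) * S.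
Proof.
move=> m0 eqx.
have -> : x = (m * (91%:R * a + 600%:R * x) / m - 91%:R * a) / 600%:R by field.
by rewrite eqx; field.
Qed.

Theorem theorem2p4 (n : nat) (hn : (1 <= n)%N) :
  (tau n)%:~R = - (91%:R / 600%:R) * (sigma 11 n)%:R
                + (691%:R / 600%:R) * (sigma 3 n)%:R
                + (4%:R * 691%:R) / (5%:R * n%:R)
                  * \sum_(1 <= m < n)
                      m%:R * (sigma 3 m)%:R * (sigma 7 (n - m)%N)%:R
    :> rat
  /\
  (tau n)%:~R = - (91%:R / 600%:R) * (sigma 11 n)%:R
                + (691%:R / 600%:R) * (sigma 7 n)%:R
                + (2%:R * 691%:R) / (5%:R * n%:R)
                  * \sum_(1 <= m < n)
                      (n - m)%N%:R * (sigma 3 m)%:R * (sigma 7 (n - m)%N)%:R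
    :> rat.
Proof.
have n0 : n%:R != 0 :> rat by rewrite Num.Theory.pnatr_eq0 -lt0n.
split.
(* The factor 120 c is 480 for c = 4 and 240 for c = 2, the constants of the two convolution
   formulas; dividing 691 * 120 c by 600 n leaves 691 c / (5 n). *)
- apply: (convol_identity_solve rat 4%:R _ _ _ _ _ n0).
  by rewrite tau_convol_l // -natrM.
- apply: (convol_identity_solve rat 2%:R _ _ _ _ _ n0).
  by rewrite tau_convol_r // -natrM.
Qed.
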